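(* Let $(M,d)$ be a metric space and let $\nu$ be a Borel probability measure on a metric subspace $(C_\varrho,\varrho)$ of $C(M)$, with topological support $\mathcal{G}$. Fix $n\in\mathbb{N}$. Let $\gamma_0,\gamma_1,\dots,\gamma_n$ be nonnegative real numbers, with at least one strictly positive, and set $$\lambda_n=\sup_{x,y\in M}\sum_{k=0}^{n}\mathbb{E}\left[d(X_k^x,X_k^y)\right]\quad\text{and}\quad \beta_n=n\left(|\mathcal{G}|_\varrho+\lambda_n\right)\max_{i=0,\ldots,n}\gamma_i .$$ Then, for every function $\varphi\in\mathrm{Lip}_{d+\varrho}\left((\mathcal{G}\times M)^{n+1},\gamma|_0^n\right)$, for all $x\in M$ and all $t>0$, $$\mathbb{P}\left(\varphi(Y_0^x,\ldots,Y_n^x)-\mathbb{E}\left[\varphi(Y_0^x,\ldots,Y_n^x)\right]>t\right)\le\exp\left(-\frac{nt^2}{12\beta_n^2}\right).$$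
   Context: $C(M)$ is the space of continuous maps $f:M\to M$; $(C_\varrho,\varrho)$ is a subset of $C(M)$ equipped with a metric $\varrho$ adapted to the regularity considered (e.g. $C(M)$ with the supremum metric, Lipschitz maps with a Lipschitz metric, or $C^r$ maps with a $C^r$-type metric). $|\mathcal{G}|_\varrho=\sup_{f,g\in\mathcal{G}}\varrho(f,g)$ is the $\varrho$-diameter. $(\Omega,\mathbb{P})=(\mathcal{G}^{\mathbb{N}},\nu^{\mathbb{N}})$ with the product $\sigma$-algebra, $\mathbb{E}$ is expectation with respect to $\mathbb{P}$. For $\omega=(f_1,f_2,\dots)\in\Omega$, $F_n[\omega]=f_n$ (so $(F_n)_{n\ge1}$ is i.i.d. with law $\nu$), $G_n[\omega]=f_n\circ\cdots\circ f_1$, $G_0=\mathrm{id}_M$. For $x\in M$: $X_n^x=G_n(x)$ and $Y_n^x=(F_{n+1},X_n^x)$, $n\ge0$. The metric $d+\varrho$ on $\mathcal{G}\times M$ is $(d+\varrho)((f,x),(g,y))=\varrho(f,g)+d(x,y)$. For a metric space $(\mathcal{X},\mathrm{dist})$, $\mathrm{Lip}_{\mathrm{dist}}(\mathcal{X}^{n+1},\gamma|_0^n)$ is the set of functions $\varphi:\mathcal{X}^{n+1}\to\mathbb{R}$ with $|\varphi(\mathtt{x}_0,\ldots,\mathtt{x}_n)-\varphi(\mathtt{y}_0,\ldots,\mathtt{y}_n)|\le\sum_{i=0}^n\gamma_i\,\mathrm{dist}(\mathtt{x}_i,\mathtt{y}_i)$ for all $(\mathtt{x}_0,\dots,\mathtt{x}_n),(\mathtt{y}_0,\dots,\mathtt{y}_n)\in\mathcal{X}^{n+1}$.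 *)

(* Defs.v *)
From HB Require Import structures.
From mathcomp Require Import all_boot all_order all_algebra.
From mathcomp Require Import all_classical all_reals all_analysis.

Set Implicit Arguments.
Unset Strict Implicit.
Unset Printing Implicit Defensive.

Import Order.TTheory GRing.Theory Num.Theory.
Import numFieldNormedType.Exports.

Local Open Scope classical_set_scope.
Local Open Scope ring_scope.

(* Measurable types are pointed in the library.  A space carrying a probability
   measure is nonempty, so asking for a base point is no restriction. *)
#[short(type="pmetricType")]
HB.structure Definition PointedMetric (K : numDomainType) :=
  {M of Metric K M & Pointed M}.

Notation borel T := (g_sigma_algebraType (@open T)).

Section support.
Context {R : realType} {T : ptopologicalType}.
Implicit Type nu : probability (borel T) R.

Definition msupport nu : set T :=
  [set f | forall U : set T, open U -> U f -> (0 < nu U)%E].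

Lemma msupport_neq0 nu : nu (msupport nu) = 1%E -> msupport nu !=set0.
Proof.
move=> h; apply/set0P/eqP => s0; move: h; rewrite s0 measure0 => /esym/eqP.
by rewrite onee_eq0.
Qed.

Definition msupport_pt nu (h : nu (msupport nu) = 1%E) : msupport nu :=
  let: exist f sf := cid (msupport_neq0 h) in exist _ f (mem_set sf).

(* The sequences (f_1, f_2, ...) in the support of nu, numbered from 0:
   [w k] is f_{k+1}.  The proof [h] only serves to provide a base point. *)
Definition sequences_of nu (h : nu (msupport nu) = 1%E) : Type :=
  nat -> msupport nu.

HB.instance Definition _ nu (h : nu (msupport nu) = 1%E) :=
  Choice.copy (sequences_of h) (nat -> msupport nu).
HB.instance Definition _ nu (h : nu (msupport nu) = 1%E) :=
  isPointed.Build (sequences_of h) (fun=> msupport_pt h).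

Definition coordinate nu (h : nu (msupport nu) = 1%E) (k : nat)
  (w : sequences_of h) : borel T := \val (w k).

(* Generators of the product sigma-algebra, each factor carrying the trace of
   the Borel sigma-algebra of T. *)
Definition coordinate_events nu (h : nu (msupport nu) = 1%E) :
    set (set (sequences_of h)) :=
  \bigcup_k preimage_set_system setT (coordinate (h := h) k) measurable.

End support.

Arguments coordinate_events {R T nu} h _.

Notation Omega h := (g_sigma_algebraType (coordinate_events h)).

(* P is the infinite product of copies of nu, i.e. the unique probability
   measure on the product sigma-algebra with these values on the cylinders.
   As nu is carried by its support, nu A is the mass of the trace of A. *)
Definition is_product_measure {R : realType} {T : ptopologicalType}
    (nu : probability (borel T) R) (h : nu (msupport nu) = 1%E)
    (P : probability (Omega h) R) : Prop :=
  forall (m : nat) (A : nat -> set (borel T)), (forall k, measurable (A k)) ->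
    P [set w | forall k, (k < m)%N -> A k (coordinate k w)] =
    (\prod_(k < m) nu (A k))%E.

Definition diameter {R : realType} {T : metricType R} (A : set T) : \bar R :=
  ereal_sup [set s | exists f g, [/\ A f, A g & s = (mdist f g)%:E]].

Definition Lip {R : realType} {T : Type} (dist : T -> T -> R) (n : nat)
    (gamma : 'I_n.+1 -> R) : set (('I_n.+1 -> T) -> R) :=
  [set phi | forall u v : 'I_n.+1 -> T,
    `|phi u - phi v| <= \sum_(i < n.+1) gamma i * dist (u i) (v i)].

Section iterations.
Context {R : realType} {M : metricType R} {C : pmetricType R}.
(* The elements of C are viewed as continuous self-maps of M through iota. *)
Variable iota : C -> continuousType M M.
Variables (nu : probability (borel C) R) (h : nu (msupport nu) = 1%E).
Variable P : probability (Omega h) R.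

(* F_k = f_k is meant for k >= 1; the value at k = 0 is junk and is never used. *)
Definition F_ (k : nat) (w : Omega h) : msupport nu := w k.-1.

Fixpoint G_ (k : nat) (w : Omega h) : M -> M :=
  if k is k'.+1 then iota (\val (F_ k w)) \o G_ k' w else id.

Definition X_ (x : M) (k : nat) (w : Omega h) : M := G_ k w x.

Definition Y_ (x : M) (k : nat) (w : Omega h) : msupport nu * M :=
  (F_ k.+1 w, X_ x k w).

Definition dist_sum (p q : msupport nu * M) : R :=
  mdist (\val p.1) (\val q.1) + mdist p.2 q.2.

Definition lambda_ (n : nat) : \bar R :=
  ereal_sup [set s | exists x y : M,
    s = (\sum_(k < n.+1) 'E_P[fun w => mdist (X_ x k w) (X_ y k w)])%E].

(* The diameter and lambda_ may be infinite.  The indices range over a nonempty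
   type and the gamma i are nonnegative, so the default value 0 of the maximum
   is immaterial. *)
Definition beta_ (n : nat) (gamma : 'I_n.+1 -> R) : \bar R :=
  (n%:R%:E * (diameter (msupport nu) + lambda_ n)
    * (\big[Num.max/0%R]_(i < n.+1) gamma i)%:E)%E.

End iterations.

(* Main.v *)
From HB Require Import structures.
Require Import Defs.
From mathcomp Require Import all_boot all_order all_algebra.
From mathcomp Require Import all_classical all_reals all_analysis.
From mathcomp Require Import measurable_realfun ring lra.

Set Implicit Arguments.
Unset Strict Implicit.
Unset Printing Implicit Defensive.

Import Order.TTheory GRing.Theory Num.Theory.
Import numFieldNormedType.Exports.

Local Open Scope classical_set_scope.
Local Open Scope ring_scope.

(* Expose the maps f_1, f_2, ... one at a time.  Given f_1, ..., f_k, replacing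
   f_{k+1} by another map of the support moves Y_k by at most the diameter of
   the support and restarts the chain from a different point, so that the
   conditional expectation of phi(Y_0, ..., Y_n) moves by at most
   c = (max gamma) (diameter + lambda_n).  A bounded differences argument over
   the n + 1 maps yields the mgf bound exp(3/2 (n + 1) (s c)^2), and Chernoff's
   inequality with s = t / (6 n c^2) concludes.
   Conditioning is replaced by the identity
   E[g] = int E[g(f, f_1, f_2, ...)] nu(df), applied recursively to the function
   obtained from phi by freezing its first argument and starting the chain at
   the image of x by f.
   When beta_n is infinite the bound still requires the event to be measurable.
   (f, x) |-> f x is only separately continuous and M need not be separable; but
   the support of nu is separable, hence functions of (f_1, ..., f_m) that are
   continuous in each variable are measurable. *)

(* The inequality holds without the factor 3/2, which makes the proof elementary
   and is the largest one that the constant 12 of the theorem allows (n = 1). *)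
Lemma expR_le_xDexpR_sqr {R : realType} (x : R) :
  expR x <= x + expR (3 / 2 * x ^+ 2).
Proof.
have [x23|x23] := leP (2 / 3) x.
  have : expR x <= expR (3 / 2 * x ^+ 2) by rewrite ler_expR; nra.
  lra.
suff : expR x <= 1 + x + 3 / 2 * x ^+ 2.
  by have := expR_ge1Dx (3 / 2 * x ^+ 2); lra.
(* For positive [x], [expR x <= (1 - x)^-1] implies the claim only up to 1/3; squaring the same
   bound at [x / 2] reaches 2/3. *)
have [x0|x0] := leP 0 x.
  have y0 : 0 < 1 - x / 2 by lra.
  have : 1 - x / 2 <= expR (- (x / 2)) by have := expR_ge1Dx (- (x / 2)); lra.
  rewrite expRN => le_inv.
  have e2 : expR (x / 2) <= (1 - x / 2)^-1.
    by rewrite -[leLHS]invrK lef_pV2// posrE// invr_gt0 expR_gt0.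
  have -> : x = x / 2 + x / 2 by field.
  rewrite expRD; apply: (@le_trans _ _ ((1 - x / 2)^-1 * (1 - x / 2)^-1)).
    by rewrite ler_pM ?expR_ge0.
  rewrite -invfM -[leLHS]mul1r ler_pdivrMr ?mulr_gt0//.
  (* [x ^+ 2] times this polynomial is (1 + x + 3/2 x^2) (1 - x/2)^2 - 1. *)
  have h : 0 <= 3 / 4 - 5 / 4 * x + 3 / 8 * x ^+ 2 by nra.
  have := mulr_ge0 (sqr_ge0 x) h.
  lra.
have le_inv : 1 - x <= (expR x)^-1.
  by rewrite -expRN; have := expR_ge1Dx (- x); lra.
have : expR x <= (1 - x)^-1.
  rewrite -[leLHS]invrK lef_pV2// posrE ?invr_gt0 ?expR_gt0//; lra.
move=> /le_trans; apply; rewrite -[leLHS]mul1r ler_pdivrMr; last lra.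
nra.
Qed.

(** * Exponential moments of variables of bounded oscillation *)

Section bounded_random_variables.
Context {d} {T : measurableType d} {R : realType} (P : probability T R).
Implicit Type h : T -> R.

Lemma bounded_integrable h (K : R) : measurable_fun setT h ->
  (forall a, `|h a| <= K) -> P.-integrable setT (EFin \o h).
Proof.
move=> mh hK; apply: measurable_bounded_integrable => //.
  by apply: le_lt_trans (probability_le1 P measurableT) _; rewrite ltry.
exists K; split; first by rewrite num_real.
by move=> r Kr a _; exact: le_trans (hK a) (ltW Kr).
Qed.

Lemma osc_bounded h (c : R) : (forall a b, `|h a - h b| <= c) ->
  forall a, `|h a| <= `|h point| + c.
Proof.
move=> hc a; rewrite -[h a](subrK (h point)).
by rewrite (le_trans (ler_normD _ _))// addrC lerD2l.
Qed.

Lemma Rintegral_prob_cst (r : R) : (\int[P]_a r)%R = r.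
Proof. by rewrite Rintegral_cst//= probability_setT/= mulr1. Qed.

Lemma normr_Rintegral_le h (K : R) : measurable_fun setT h ->
  (forall a, `|h a| <= K) -> `|(\int[P]_a h a)%R| <= K.
Proof.
move=> mh hK; have ih := bounded_integrable mh hK.
apply: le_trans (le_normr_Rintegral _ ih) _ => //.
rewrite -[leRHS]Rintegral_prob_cst; apply: le_Rintegral => //.
  by apply: (@bounded_integrable _ K) => [|a]; rewrite ?normr_id//; exact: measurableT_comp.
by apply: (@bounded_integrable (cst K) `|K|).
Qed.

Lemma le_dist_Rintegral h (c : R) : measurable_fun setT h ->
  (forall a b, `|h a - h b| <= c) ->
  forall a, `|h a - (\int[P]_b h b)%R| <= c.
Proof.
move=> mh hc a.
have ih := bounded_integrable mh (osc_bounded hc).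
have ic r : P.-integrable setT (EFin \o cst r : T -> \bar R).
  exact: (@bounded_integrable (cst r) `|r|).
have -> : h a - (\int[P]_b h b)%R = (\int[P]_b (h a - h b))%R.
  by rewrite RintegralB// ?Rintegral_prob_cst//; exact: ic.
have mhB : measurable_fun setT (fun b => h a - h b) by exact: measurable_funB.
exact: normr_Rintegral_le.
Qed.

(** A Hoeffding-type bound with 3/2 in place of the sharp 1/8. The mean averages the values of [h],
    so [h] stays within [c] of it. *)
Lemma mgf_le_osc h (c s : R) : measurable_fun setT h ->
  (forall a b, `|h a - h b| <= c) ->
  (\int[P]_a expR (s * h a) <= expR (3 / 2 * (s * c) ^+ 2 + s * \int[P]_a h a))%R.
Proof.
move=> mh hc; set m := (\int[P]_a h a)%R.
have ih := bounded_integrable mh (osc_bounded hc).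
have ic r : P.-integrable setT (EFin \o cst r : T -> \bar R).
  exact: (@bounded_integrable (cst r) `|r|).
have hm := le_dist_Rintegral mh hc.
pose K := expR (3 / 2 * (s * c) ^+ 2).
(* expR_le_xDexpR_sqr at s (h a - m), whose linear term has mean 0 *)
have ub a : expR (s * h a) <= expR (s * m) * (s * (h a - m) + K).
  rewrite -[s * h a](subrK (s * m)) -mulrBr expRD mulrC ler_pM2l ?expR_gt0//.
  apply: le_trans (expR_le_xDexpR_sqr _) _; rewrite lerD2l ler_expR.
  have := hm a; rewrite -/m ler_norml => /andP[? ?].
  by rewrite ler_pM2l// !exprMn ler_wpM2l ?sqr_ge0//; nra.
have mub : measurable_fun setT (fun a => s * (h a - m) + K).
  by apply: measurable_funD => //; apply: measurable_funM => //; exact: measurable_funB.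
have iB : P.-integrable setT (EFin \o (fun a => h a - m)).
  by apply: (@bounded_integrable _ c) => //; exact: measurable_funB.
have isB : P.-integrable setT (EFin \o (fun a => s * (h a - m))).
  apply: (@bounded_integrable _ (`|s| * c)) => [|a].
    by apply: measurable_funM => //; exact: measurable_funB.
  by rewrite normrM ler_wpM2l.
have iub : P.-integrable setT (EFin \o (fun a => s * (h a - m) + K)).
  apply: (@bounded_integrable _ (`|s| * c + `|K|)) => // a.
  by rewrite (le_trans (ler_normD _ _))// lerD2r normrM ler_wpM2l.
have -> : expR (3 / 2 * (s * c) ^+ 2 + s * m) =
    (\int[P]_a (expR (s * m) * (s * (h a - m) + K)))%R.
  rewrite RintegralZl// RintegralD//; last exact: ic.
  rewrite RintegralZl// RintegralB//; last exact: ic.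
  by rewrite !Rintegral_prob_cst subrr mulr0 add0r -expRD addrC.
apply: le_Rintegral => //.
  apply: (@bounded_integrable _ (expR (`|s| * (`|h point| + c)))) => [|a].
    by apply: measurableT_comp => //; exact: measurable_funM.
  rewrite ger0_norm ?expR_ge0// ler_expR (le_trans (ler_norm _))// normrM.
  by rewrite ler_wpM2l// osc_bounded.
apply: (@bounded_integrable _ (expR (s * m) * (`|s| * c + `|K|))) => [|a].
  exact: measurable_funM.
rewrite normrM ger0_norm ?expR_ge0// ler_wpM2l ?expR_ge0//.
by rewrite (le_trans (ler_normD _ _))// lerD2r normrM ler_wpM2l.
Qed.

End bounded_random_variables.

(** * Separability of the support *)

(** Among disjoint events, fewer than k + 2 have mass above 1/(k + 1), as the total mass is at most
    1; the index set is thus a countable union of finite sets. *)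
Lemma countable_disjoint_positive {d} {T : measurableType d} {R : realType}
    (P : probability T R) {I : pointedType} (A : set I) (F : I -> set T) :
  (forall i, A i -> measurable (F i)) -> trivIset A F ->
  (forall i, A i -> (0 < P (F i))%E) -> countable A.
Proof.
move=> mF tF F0.
have -> : A = \bigcup_k [set i | A i /\ (k.+1%:R^-1%:E < P (F i))%E].
  apply/seteqP; split=> [i Ai|i [k _] []//].
  have Pfin : P (F i) \is a fin_num by exact/fin_num_measure/mF.
  have p0 : 0 < fine (P (F i)) by rewrite -lte_fin fineK// F0.
  have [k _ /(_ _ (leqnn k)) hk] := near_infty_natSinv_lt (PosNum p0).
  by exists k => //; split => //; rewrite -(fineK Pfin) lte_fin.
apply: bigcup_countable => // k _; apply: finite_set_countable.
apply: contrapT => /infiniteP/pcard_leP/injfunPex[/= f fA f_inj].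
have mFf i : measurable (F (f i)) by apply: mF; have [] := fA i Logic.I.
have tFf : trivIset setT (F \o f).
  move=> i j _ _ /= Fij; apply: f_inj; rewrite ?in_setT//.
  by apply: tF Fij; [have [] := fA i Logic.I|have [] := fA j Logic.I].
have mU : measurable (\big[setU/set0]_(i < k.+2) F (f i)).
  by apply: bigsetU_measurable.
have := probability_le1 P mU.
rewrite (@measure_bigsetU_ord _ _ _ P _ predT (fun i : 'I_k.+2 => F (f i)))//; last first.
  by move=> i j _ _ /(tFf _ _ Logic.I Logic.I)/val_inj.
rewrite leNgt => /negP; apply.
apply: (@lt_le_trans _ _ (\sum_(i < k.+2) (k.+1%:R^-1%:E))%E).
  rewrite sumEFin lte_fin sumr_const card_ord -[ltRHS]mulr_natl ltr_pdivlMr// mul1r.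
  by rewrite ltr_nat.
by apply: lee_sum => i _; apply: ltW; have [] := fA i Logic.I.
Qed.

Section separable_support.
Context {R : realType} {C : pmetricType R} (nu : probability (borel C) R).

Lemma open_mdist_ball (c : C) (e : R) : open [set y | mdist c y < e].
Proof.
rewrite openE => y /= cye; apply/metricType_numDomainType.nbhs_mdistP.
exists (e - mdist c y); first by rewrite /= subr_gt0.
move=> z /= yz; apply: le_lt_trans (metric_triangle c y z) _.
by rewrite addrC -ltrBrDr.
Qed.

Lemma measurable_mdist_ball (c : C) (e : R) :
  measurable ([set y | mdist c y < e] : set (borel C)).
Proof. by apply: sub_sigma_algebra; exact: open_mdist_ball. Qed.

(** The balls of radius [e / 2] around the points of [A] are disjoint, and each has positive mass
    because its centre lies in the support. *)
Lemma countable_separated (A : set C) (e : R) : 0 < e -> A `<=` msupport nu ->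
  (forall a b, A a -> A b -> a != b -> e <= mdist a b) -> countable A.
Proof.
move=> e0 Asupp sepA.
apply: (@countable_disjoint_positive _ _ _ nu C A
  (fun a => [set y | mdist a y < e / 2])).
- by move=> a _; exact: measurable_mdist_ball.
- apply/trivIsetP => a b Aa Ab ab; apply/seteqP; split => // y [/= ay by'].
  have := sepA _ _ Aa Ab ab; have := metric_triangle a y b.
  by rewrite (metric_sym y b); lra.
- move=> a Aa; apply: (Asupp _ Aa); first exact: open_mdist_ball.
  by rewrite /= mdistxx divr_gt0.
Qed.

(* By Zorn's lemma: a maximal separated subset of the support. *)
Lemma ex_countable_net (e : R) : 0 < e -> exists A : set C,
  [/\ countable A, A `<=` msupport nu &
   forall c, msupport nu c -> exists2 a, A a & mdist a c < e].
Proof.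
move=> e0.
pose sep (A : set C) := A `<=` msupport nu /\
  (forall a b, A a -> A b -> a != b -> e <= mdist a b).
have [F Fsep Ftot|A [[Asupp sepA] maxA]] := @Zorn_bigcup C sep.
  split=> [a [X /Fsep[Xsupp _]] /Xsupp//|a b [X FX Xa] [Y FY Yb]].
  have [XY|YX] := Ftot _ _ FX FY.
    by have [_] := Fsep _ FY; apply => //; exact: XY.
  by have [_] := Fsep _ FX; apply => //; exact: YX.
exists A; split => // [|c suppc]; first exact: countable_separated sepA.
apply: contrapT => far.
have cfar a : A a -> e <= mdist a c.
  by move=> Aa; rewrite leNgt; apply/negP => ac; apply: far; exists a.
have Ac : ~ A c by move=> /cfar; rewrite mdistxx leNgt e0.
apply: (maxA (c |` A)).
  by split=> [|cA]; [exact: subsetUr|apply: Ac; apply: cA; left].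
split=> [a [->//|/Asupp//]|a b [->|Aa] [->|Ab]].
- by rewrite eqxx.
- by rewrite metric_sym => _; exact: cfar.
- by move=> _; exact: cfar.
- exact: sepA.
Qed.

(** The union over k of countable 1/(k + 1)-nets is dense; [q] enumerates it. *)
Lemma separable_msupport : nu (msupport nu) = 1%E ->
  exists q : nat -> msupport nu, forall (a : msupport nu) (e : R), 0 < e ->
    exists j, mdist (\val (q j)) (\val a) < e.
Proof.
move=> nu1.
have /choice[A hA] : forall k, exists A : set C,
  [/\ countable A, A `<=` msupport nu &
   forall c, msupport nu c -> exists2 a, A a & mdist a c < k.+1%:R^-1].
  by move=> k; apply: ex_countable_net; rewrite invr_gt0.
have cA : countable (\bigcup_k A k) by apply: bigcup_countable => // k _; have [] := hA k.
have /pcard_surjP[g gsurj] := cA.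
(* The surjection [g] covers the nets but may also take values outside the support; these are
   replaced by the base point. *)
pose q j : msupport nu := if pselect (msupport nu (g j)) is left gj
  then exist _ (g j) (mem_set gj) else msupport_pt nu1.
exists q => a e e0.
have [k _ /(_ _ (leqnn k)) hk] := near_infty_natSinv_lt (PosNum e0).
have [_ Asupp /(_ (\val a) (set_mem (valP a)))[c Akc ca]] := hA k.
have [j _ gj] := gsurj c (ex_intro2 _ _ k Logic.I Akc).
exists j; rewrite /q; case: pselect => [|[]] /=; last by rewrite gj; exact: Asupp Akc.
by move=> ?; rewrite gj; exact: lt_trans ca hk.
Qed.

End separable_support.

(** * Splitting a random sequence into its head and its tail *)

Section sequence_space.
Context {R : realType} {T : ptopologicalType} {nu : probability (borel T) R}.
Variable h : nu (msupport nu) = 1%E.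

Definition seq_cons (a : msupport nu) (w : Omega h) : Omega h :=
  fun k => if k is k'.+1 then w k' else a.

Definition seq_shift (w : Omega h) : Omega h := fun k => w k.+1.

Lemma seq_cons_shift (w : Omega h) : seq_cons (w 0%N) (seq_shift w) = w.
Proof. by apply/funext => -[]. Qed.

Lemma measurable_coordinate k :
  measurable_fun setT (coordinate k : Omega h -> borel T).
Proof.
move=> _ B mB; rewrite setTI; apply: sub_sigma_algebra.
by exists k => //; exists B => //; rewrite setTI.
Qed.

Lemma measurable_to_sequences {d} {X : measurableType d} (f : X -> Omega h) :
  (forall k, measurable_fun setT (fun x => (coordinate k (f x : sequences_of h)) : borel T)) ->
  measurable_fun setT f.
Proof.
move=> mf; apply: (@measurability _ _ _ (Omega h) _ _ (coordinate_events h)) => // _ [_ [k _ [B mB <-]] <-].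
by rewrite !setTI -comp_preimage -[X in measurable X]setTI; exact: mf.
Qed.

Lemma measurable_seq_cons a : measurable_fun setT (seq_cons a).
Proof.
apply: measurable_to_sequences => -[|k]; first exact: measurable_cst.
exact: measurable_coordinate.
Qed.

Lemma measurable_seq_shift : measurable_fun setT seq_shift.
Proof. by apply: measurable_to_sequences => k; exact: measurable_coordinate. Qed.

(* Under P \x P, the head of p.1 and the whole of p.2 are independent, with laws
   nu and P. *)
Definition head_cons (p : Omega h * Omega h) : Omega h := seq_cons (p.1 0%N) p.2.

Lemma measurable_head_cons : measurable_fun setT head_cons.
Proof.
apply: measurable_to_sequences => -[|k].
  exact: (measurableT_comp (measurable_coordinate 0) measurable_fst).
exact: (measurableT_comp (measurable_coordinate k) measurable_snd).
Qed.

HB.instance Definition _ := isMeasurableFun.Build _ _ _ _ _ measurable_head_cons.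

Definition cylinder m (A : nat -> set (borel T)) : set (Omega h) :=
  [set w | forall k, (k < m)%N -> A k (coordinate k w)].

Lemma measurable_cylinder m A :
  (forall k, measurable (A k)) -> measurable (cylinder m A).
Proof.
move=> mA.
have -> : cylinder m A = \bigcap_(k in `I_m) coordinate k @^-1` A k.
  by apply/seteqP; split.
apply: bigcap_measurableType => k _; rewrite -[X in measurable X]setTI.
exact: measurable_coordinate.
Qed.

Definition cylinders : set (set (Omega h)) :=
  [set B | exists m A, (forall k, measurable (A k)) /\ B = cylinder m A].

Lemma setI_closed_cylinders : setI_closed cylinders.
Proof.
move=> _ _ [m [A [mA ->]]] [n [B [mB ->]]].
(* Each family is padded with [setT] beyond its own length, so that the longer cylinder adds no
   constraint. *)
exists (maxn m n), (fun k => (if (k < m)%N then A k else setT) `&`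
                             (if (k < n)%N then B k else setT)); split.
  by move=> k; apply: measurableI; case: ifP.
apply/seteqP; split=> [w [wA wB] k _|w wAB].
  by split; case: ifP => // kmn; [exact: wA|exact: wB].
split=> k km; have := wAB k; rewrite leq_max km ?orbT => /(_ isT)[].
  by [].
by [].
Qed.

Lemma measurable_cylindersE : @measurable _ (Omega h) = <<s cylinders >>.
Proof.
apply/seteqP; split.
  apply: smallest_sub; first exact: smallest_sigma_algebra.
  move=> _ [k _ [B mB <-]]; apply: sub_sigma_algebra.
  exists k.+1, (fun i => if i == k then B else setT); split.
    by move=> i; case: ifP.
  rewrite setTI; apply/seteqP; split=> [w Bw i _|w /(_ k (ltnSn k))].
    by case: eqP => // ->.
  by rewrite eqxx.
apply: smallest_sub; first exact: sigma_algebra_measurable.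
by move=> _ [m [A [mA ->]]]; exact: measurable_cylinder.
Qed.

Variables (P : probability (Omega h) R) (P_prod : is_product_measure P).

Lemma product_measure_cylinder m A : (forall k, measurable (A k)) ->
  P (cylinder m A) = (\prod_(k < m) nu (A k))%E.
Proof. exact: P_prod. Qed.

(** An i.i.d. sequence preceded by an independent term of the same law has the same law. The
    cylinders form a generating pi-system, so it suffices to compare the two measures there. *)
Lemma pushforward_head_cons (A : set (Omega h)) : measurable A ->
  pushforward (P \x P)%E head_cons A = P A.
Proof.
apply: (measure_unique cylinders (fun=> setT)) => //.
- exact: measurable_cylindersE.
- exact: setI_closed_cylinders.
- move=> _; exists 0%N, (fun=> setT); split => //.
  by apply/seteqP; split.
- by rewrite bigcup_const.
- move=> _ [m [B [mB ->]]]; transitivity (\prod_(k < m) nu (B k))%E;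
    last by rewrite -product_measure_cylinder.
  case: m => [|m].
    rewrite big_ord0; transitivity ((P \x P)%E setT); last exact: probability_setT.
    by congr ((P \x P) _)%E; apply/seteqP; split.
  (* The preimage of a nonempty cylinder is a rectangle: the first constraint bears on the head, the
     others, shifted by one, on the tail. *)
  transitivity ((P \x P) (cylinder 1 B `*` cylinder m (fun k => B k.+1)))%E.
    congr ((P \x P) _)%E; apply/seteqP; split=> [[a b] /= abB|[a b] [/= aB bB]].
      split=> /= [[|//] _|k km]; first exact: (abB 0%N).
      exact: (abB k.+1).
    by move=> [_|k km]; [exact: (aB 0%N)|exact: bB].
  transitivity (P (cylinder 1 B) * P (cylinder m (fun k => B k.+1)))%E.
    by apply: product_measure1E; exact: measurable_cylinder.
  rewrite !product_measure_cylinder// big_ord_recl big_ord0 mule1.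
  by rewrite [in RHS]big_ord_recl.
- by move=> _; exact: (le_lt_trans (probability_le1 (P \x P)%E measurableT) (ltry 1)).
Qed.

Section head_integration.
Variables (g : Omega h -> R) (K : R).
Hypotheses (mg : measurable_fun setT g) (gK : forall w, `|g w| <= K).

Let integrable_head_cons :
  (P \x P)%E.-integrable setT (EFin \o (g \o head_cons)).
Proof.
apply: (@bounded_integrable _ _ _ _ _ K) => [|p]; last exact: gK.
exact: measurableT_comp mg measurable_head_cons.
Qed.

Let inner_EFin (a : Omega h) : (\int[P]_b (g (seq_cons (a 0%N) b))%:E)%E =
  (\int[P]_b g (seq_cons (a 0%N) b))%R%:E.
Proof.
rewrite fineK//; apply: integrable_fin_num => //.
apply: (@bounded_integrable _ _ _ _ _ K) => [|b]; last exact: gK.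
exact: measurableT_comp mg (measurable_seq_cons _).
Qed.

Lemma measurable_Rintegral_seq_cons :
  measurable_fun setT (fun a : Omega h => \int[P]_b g (seq_cons (a 0%N) b))%R.
Proof.
apply/measurable_EFinP.
have := measurable_fubini_F integrable_head_cons.
apply: eq_measurable_fun => a _.
exact: inner_EFin.
Qed.

(** Change of variables along [head_cons], then Fubini. The outer integral runs over whole sequences
    [a] but reads only [a 0], whose law is [nu]; this spares a measurable structure on the
    support. *)
Lemma Rintegral_seq_cons :
  (\int[P]_w g w = \int[P]_(a in [set: Omega h]) \int[P]_b g (seq_cons (a 0%N) b))%R.
Proof.
congr fine.
transitivity (\int[pushforward (P \x P)%E head_cons]_w (g w)%:E)%E.
  by apply: eq_measure_integral => A mA _; apply/esym; exact: pushforward_head_cons.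
rewrite integral_pushforward//=; last exact/measurable_EFinP.
rewrite -(integral12_prod_meas1 integrable_head_cons).
by apply: eq_integral => a _; exact: inner_EFin.
Qed.

End head_integration.

End sequence_space.

(** * Measurability from continuity in the head *)

Lemma measurable_countable_pieces {d d'} {X : measurableType d}
    {Y : measurableType d'} (idx : X -> nat) (f : nat -> X -> Y) :
  (forall j, measurable [set x | idx x = j]) ->
  (forall j, measurable_fun setT (f j)) ->
  measurable_fun setT (fun x => f (idx x) x).
Proof.
move=> midx mf _ B mB; rewrite setTI.
have -> : (fun x => f (idx x) x) @^-1` B =
    \bigcup_j ([set x | idx x = j] `&` f j @^-1` B).
  apply/seteqP; split=> [x Bx|x [j _ [/= <-]]//].
  by exists (idx x).
apply: bigcupT_measurable => j; apply: measurableI => //.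
by rewrite -[X in measurable X]setTI; exact: mf.
Qed.

(* Moving the head to the first point of a dense sequence at distance less than
   1 / (r + 1) gives measurable functions that converge pointwise to g. *)
Lemma measurable_continuous_head {R : realType} {C : pmetricType R}
    {nu : probability (borel C) R} (h : nu (msupport nu) = 1%E)
    (g : Omega h -> R) :
  (forall a, measurable_fun setT (fun w => g (seq_cons a w))) ->
  (forall w (a : msupport nu) (e : R), 0 < e -> exists2 del : R, 0 < del & forall b : msupport nu,
    mdist (\val a) (\val b) < del -> `|g (seq_cons a w) - g (seq_cons b w)| < e) ->
  measurable_fun setT g.
Proof.
move=> mg cg; have [q hq] := separable_msupport h.
have qr r (a : msupport nu) : exists j, mdist (\val (q j)) (\val a) < r.+1%:R^-1.
  by apply: hq; rewrite invr_gt0.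
(* Taking the least index makes each level set of [idx r] one [near_q] minus finitely many others,
   hence measurable. *)
pose idx r (w : Omega h) := ex_minn (qr r (w 0%N)).
pose near_q r j : set (Omega h) :=
  coordinate (h := h) 0 @^-1` [set c | mdist (\val (q j)) c < r.+1%:R^-1].
have mnear r j : measurable (near_q r j).
  rewrite -[X in measurable X]setTI; apply: measurable_coordinate => //.
  exact: measurable_mdist_ball.
have midx r j : measurable [set w | idx r w = j].
  have -> : [set w | idx r w = j] =
      near_q r j `&` \bigcap_(i in [set i | (i < j)%N]) ~` near_q r i.
    apply/seteqP; split=> [w /=|w [wj wi]] /=; rewrite /idx; case: ex_minnP => i qi mini.
      move=> <-; split => // k /= ki; rewrite /near_q/= => /mini.
      by rewrite leqNgt ki.
    apply/eqP; rewrite eqn_leq mini//= leqNgt; apply/negP => ij.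
    exact: (wi _ ij).
  by apply: measurableI => //; apply: bigcap_measurableType => i _; exact: measurableC.
apply: (@measurable_fun_cvg _ _ _ _
  (fun r w => g (seq_cons (q (idx r w)) (seq_shift w)))) => [r|w _].
  apply: (measurable_countable_pieces (f := fun j w => g (seq_cons (q j) (seq_shift w)))) => // j.
  exact: (measurableT_comp (mg (q j)) (measurable_seq_shift (h := h))).
apply/cvgrPdist_lt => e e0.
have [del del0 hdel] := cg (seq_shift w) (w 0%N) e e0.
near=> r.
rewrite -{1}(@seq_cons_shift _ _ _ h w); apply: hdel.
rewrite /idx; case: ex_minnP => j + _; rewrite metric_sym => /lt_trans; apply.
by near: r; exact: (near_infty_natSinv_lt (PosNum del0)).
Unshelve. all: by end_near. Qed.

(** * Dependence of the chain on its first map *)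

Section iterated_maps.
Context {R : realType} {M : metricType R} {C : pmetricType R}.
Variable iota : C -> continuousType M M.
Hypothesis iota_ptws : forall x : M, continuous (fun f : C => iota f x : M).
Variables (nu : probability (borel C) R) (h : nu (msupport nu) = 1%E).

Local Notation S := (msupport nu).
Implicit Types (a b : S) (w : Omega h) (x y : M).

(** [G_] unfolds at the last map whereas this peels off the first one, whence the induction on
    [k]. *)
Lemma X_seq_cons x k a w :
  X_ iota x k.+1 (seq_cons a w) = X_ iota (iota (\val a) x) k w.
Proof.
elim: k => [//|k IHk].
by transitivity (iota (\val (w k)) (X_ iota x k.+1 (seq_cons a w))); [|rewrite IHk].
Qed.

Lemma continuous_X k w : continuous (fun x => X_ iota x k w).
Proof.
elim: k => [|k IHk] x; first exact: cvg_id.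
exact: (continuous_comp (IHk x) (@cts_fun _ _ (iota (\val (F_ k.+1 w))) _)).
Qed.

(** With the tail fixed, evaluation at [x], continuous by [iota_ptws], is followed by the continuous
    map of [continuous_X]. *)
Lemma X_head_dist_lt x k w a (e : R) : 0 < e -> exists2 del : R, 0 < del &
  forall b, mdist (\val a) (\val b) < del ->
    mdist (X_ iota (iota (\val a) x) k w) (X_ iota (iota (\val b) x) k w) < e.
Proof.
move=> e0.
have cX : continuous (fun c : C => X_ iota (iota c x) k w).
  by move=> c; exact: (continuous_comp (@iota_ptws x c) (@continuous_X k w _)).
have : \forall c \near (\val a : C),
    mdist (X_ iota (iota (\val a) x) k w) (X_ iota (iota c x) k w) < e.
  exact: (metricType_numDomainType.cvgr_dist_lt (cX (\val a)) e0).
move=> /metricType_numDomainType.nbhs_mdistP[del /= del0 hdel].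
exists del => // b; exact: hdel.
Qed.

Lemma sum_X_head_dist_lt x m w a (e : R) : 0 < e -> exists2 del : R, 0 < del &
  forall b, mdist (\val a) (\val b) < del ->
    \sum_(k < m) mdist (X_ iota (iota (\val a) x) k w)
                       (X_ iota (iota (\val b) x) k w) < e.
Proof.
elim: m e => [|m IHm] e e0; first by exists 1 => // b _; rewrite big_ord0.
have e2 : 0 < e / 2 by lra.
have [d1 d10 h1] := IHm _ e2.
have [d2 d20 h2] := X_head_dist_lt x m w a e2.
exists (Num.min d1 d2) => [|b]; first by rewrite lt_min d10.
rewrite lt_min => /andP[/h1 b1 /h2 b2].
by rewrite big_ord_recr /=; lra.
Qed.

(** By induction on [k]: with the head fixed, the chains restart from the two images, and the
    distance is continuous in the head. Treating the real-valued distance directly avoids asking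
    that the M-valued map [X_] be measurable. *)
Lemma measurable_dist_X x y k :
  measurable_fun setT (fun w => mdist (X_ iota x k w) (X_ iota y k w)).
Proof.
elim: k x y => [|k IHk] x y; first exact: (measurable_cst (mdist x y)).
apply: measurable_continuous_head => [a|w a e e0].
  by under eq_fun do rewrite !X_seq_cons; exact: IHk.
have e2 : 0 < e / 2 by lra.
have [d1 d10 h1] := X_head_dist_lt x k w a e2.
have [d2 d20 h2] := X_head_dist_lt y k w a e2.
exists (Num.min d1 d2) => [|b]; first by rewrite lt_min d10.
rewrite lt_min !X_seq_cons => /andP[/h1 + /h2].
set xa := X_ _ _ _ _; set xb := X_ _ _ _ _.
set ya := X_ _ _ _ _; set yb := X_ _ _ _ _ => hx hy.
(* Together these give |d(xa, ya) - d(xb, yb)| <= d(xa, xb) + d(ya, yb). *)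
have := metric_triangle xa xb ya; have := metric_triangle xb yb ya.
have := metric_triangle xb xa yb; have := metric_triangle xa ya yb.
rewrite (metric_sym xb xa) (metric_sym yb ya) => *.
by rewrite ltr_norml; apply/andP; split; lra.
Qed.

(** All weights are replaced by one constant, and [phi] takes infinite sequences of which only the
    first [m] terms matter: the induction can then lower [m] without changing the type of [phi]. *)
Definition sum_lip (Gam : R) (m : nat) (phi : (nat -> S * M) -> R) : Prop :=
  forall u v, `|phi u - phi v| <= Gam * \sum_(k < m) dist_sum (u k) (v k).

Definition path_value (phi : (nat -> S * M) -> R) x w : R :=
  phi (fun k => Y_ iota x k w).

Definition fix_head (phi : (nat -> S * M) -> R) (p : S * M) (u : nat -> S * M) : R :=
  phi (fun k => if k is k'.+1 then u k' else p).

Lemma dist_sumxx (p : S * M) : dist_sum p p = 0.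
Proof. by rewrite /dist_sum !mdistxx addr0. Qed.

Lemma sum_lip_fix_head Gam m phi p :
  sum_lip Gam m.+1 phi -> sum_lip Gam m (fix_head phi p).
Proof.
move=> lip u v; apply: le_trans (lip _ _) _.
by rewrite big_ord_recl /= dist_sumxx add0r.
Qed.

Lemma path_value_seq_cons phi x a w : path_value phi x (seq_cons a w) =
  path_value (fix_head phi (a, x)) (iota (\val a) x) w.
Proof.
congr phi; apply/funext => -[//|k].
exact: congr2 (erefl _) (X_seq_cons _ _ _ _).
Qed.

(** The two values of Y_0 share the point [x] and differ only in the map; the later ones share the
    map and differ only in the point. *)
Lemma path_value_head_le Gam m phi x a b w : sum_lip Gam m.+1 phi ->
  `|path_value phi x (seq_cons a w) - path_value phi x (seq_cons b w)| <=
  Gam * (mdist (\val a) (\val b) +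
         \sum_(k < m) mdist (X_ iota (iota (\val a) x) k w)
                            (X_ iota (iota (\val b) x) k w)).
Proof.
move=> lip; apply: le_trans (lip _ _) _.
rewrite big_ord_recl /= {1}/dist_sum /= mdistxx addr0.
rewrite (eq_bigr (fun k : 'I_m => mdist (X_ iota (iota (\val a) x) k w)
                                    (X_ iota (iota (\val b) x) k w)))// => k _.
by rewrite -[bump 0 k]/(k.+1) /dist_sum /Y_ !X_seq_cons /= mdistxx add0r.
Qed.

Lemma measurable_path_value (Gam : R) m phi x : 0 <= Gam -> sum_lip Gam m phi ->
  measurable_fun setT (path_value phi x : Omega h -> R).
Proof.
move=> Gam0; elim: m phi x => [|m IHm] phi x lip.
  have cphi w : path_value phi x w = path_value phi x (point : Omega h).
    apply/eqP; rewrite -subr_eq0 -normr_le0.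
    by apply: le_trans (lip _ _) _; rewrite big_ord0 mulr0.
  by rewrite (funext cphi); exact: measurable_cst.
apply: measurable_continuous_head => [a|w a e e0].
  under eq_fun do rewrite path_value_seq_cons.
  by apply: IHm; exact: sum_lip_fix_head.
(* The head and the tail each get half of [e / (Gam + 1)]; the denominator stays positive when [Gam]
   is 0, and [Gam / (Gam + 1)] is below 1. *)
have e2 : 0 < e / (2 * (Gam + 1)) by rewrite divr_gt0// mulr_gt0//; lra.
have [del del0 hdel] := sum_X_head_dist_lt x m w a e2.
exists (Num.min del (e / (2 * (Gam + 1)))) => [|b]; first by rewrite lt_min del0.
rewrite lt_min => /andP[/hdel h1 h2].
apply: le_lt_trans (path_value_head_le _ _ _ _ lip) _.
apply: (@le_lt_trans _ _ (Gam * (e / (Gam + 1)))).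
  rewrite ler_wpM2l//.
  have -> : e / (Gam + 1) = e / (2 * (Gam + 1)) + e / (2 * (Gam + 1)).
    by field; lra.
  by rewrite lerD// ltW.
by rewrite mulrA ltr_pdivrMr; nra.
Qed.

End iterated_maps.

(** * Exponential moment of a Lipschitz function of the path *)

Section concentration.
Context {R : realType} {M : metricType R} {C : pmetricType R}.
Variable iota : C -> continuousType M M.
Hypothesis iota_ptws : forall x : M, continuous (fun f : C => iota f x : M).
Variables (nu : probability (borel C) R) (h : nu (msupport nu) = 1%E).
Variables (P : probability (Omega h) R) (P_prod : is_product_measure P).

Local Notation S := (msupport nu).
Implicit Types (a b : S) (w : Omega h) (x y : M).

Variables (n : nat) (diam lam Gam : R).
Hypothesis Gam0 : 0 <= Gam.
Hypothesis le_diam : forall a b, mdist (\val a) (\val b) <= diam.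
Hypothesis le_lam0 : forall x y, mdist x y <= lam.
Hypothesis le_lam : forall m x y, (m <= n)%N ->
  (\int[P]_w (\sum_(k < m) mdist (X_ iota x k w) (X_ iota y k w)) <= lam)%R.

(** By [le_lam0], M has diameter at most [lam], so each of the [m] terms moves by at most
    [diam + lam]. This crude bound serves for integrability and for the degenerate cases. *)
Lemma dist_path_value_le m phi x w w' : sum_lip Gam m phi ->
  `|path_value iota phi x w - path_value iota phi x w'| <= Gam * (m%:R * (diam + lam)).
Proof.
move=> lip; apply: le_trans (lip _ _) _; rewrite ler_wpM2l//.
apply: le_trans (ler_sum _ (G := fun=> diam + lam) _) _ => [k _|].
  by rewrite lerD.
by rewrite sumr_const card_ord mulr_natl.
Qed.

Lemma path_value_bounded m phi x w : sum_lip Gam m phi ->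
  `|path_value iota phi x w| <= `|path_value iota phi x (point : Omega h)|
                                + Gam * (m%:R * (diam + lam)).
Proof.
move=> lip; rewrite -[path_value _ _ _ w](subrK (path_value iota phi x (point : Omega h))).
by rewrite (le_trans (ler_normD _ _))// addrC lerD2l; exact: dist_path_value_le.
Qed.

(** The two chains are coupled by the same tail [w]. Integrating [path_value_head_le] leaves the
    distances at times 0 to m - 1, controlled by [le_lam]; the resulting bound is free of the factor
    [m]. *)
Lemma Rintegral_path_value_head_le m phi x a b : (m <= n)%N ->
  sum_lip Gam m.+1 phi ->
  `|(\int[P]_w path_value iota phi x (seq_cons a w)
    - \int[P]_w path_value iota phi x (seq_cons b w))%R| <= Gam * (diam + lam).
Proof.
move=> mn lip.
have mZ : measurable_fun setT (path_value iota phi x : Omega h -> R).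
  exact: measurable_path_value lip.
have mc c : measurable_fun setT (fun w => path_value iota phi x (seq_cons c w)).
  exact: measurableT_comp mZ (measurable_seq_cons c).
have ic c : P.-integrable setT (EFin \o (fun w => path_value iota phi x (seq_cons c w))).
  exact: (@bounded_integrable _ _ _ P _ _ (mc c)
            (fun w => path_value_bounded x (seq_cons c w) lip)).
have mB : measurable_fun setT (fun w =>
    path_value iota phi x (seq_cons a w) - path_value iota phi x (seq_cons b w)).
  exact: measurable_funB.
have iB : P.-integrable setT (EFin \o (fun w =>
    path_value iota phi x (seq_cons a w) - path_value iota phi x (seq_cons b w))).
  exact: (@bounded_integrable _ _ _ P _ _ mB
            (fun w => dist_path_value_le x _ _ lip)).
pose D w := \sum_(k < m) mdist (X_ iota (iota (\val a) x) k w)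
                               (X_ iota (iota (\val b) x) k w).
have mD : measurable_fun setT D.
  by apply: measurable_sum => k; exact: measurable_dist_X.
have D0 w : 0 <= D w by apply: sumr_ge0 => k _; exact: mdist_ge0.
have Dle w : `|D w| <= m%:R * lam.
  rewrite ger0_norm//; apply: le_trans (ler_sum _ (G := fun=> lam) _) _ => [k _|].
    exact: le_lam0.
  by rewrite sumr_const card_ord mulr_natl.
have iD : P.-integrable setT (EFin \o D) by exact: bounded_integrable Dle.
have ir (r : R) : P.-integrable setT (EFin \o (cst r : Omega h -> R)).
  exact: (@bounded_integrable _ _ _ _ (cst r) `|r|).
have diam0 : 0 <= diam by apply: le_trans (le_diam a a); exact: mdist_ge0.
rewrite -RintegralB//; apply: le_trans (le_normr_Rintegral _ _) _ => //.
apply: (@le_trans _ _ (\int[P]_w (Gam * (diam + D w)))%R).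
  apply: le_Rintegral => //.
  - apply: (@bounded_integrable _ _ _ _ _ (Gam * (m.+1%:R * (diam + lam)))) => [|w].
      exact: measurableT_comp.
    by rewrite normr_id; exact: dist_path_value_le lip.
  - apply: (@bounded_integrable _ _ _ _ _ (Gam * (diam + m%:R * lam))) => [|w].
      by apply: measurable_funM => //; exact: measurable_funD.
    rewrite normrM (ger0_norm Gam0) ler_wpM2l// (le_trans (ler_normD _ _))//.
    by rewrite (ger0_norm diam0) lerD2l.
  - move=> w _; apply: le_trans (path_value_head_le iota x a b w lip) _.
    by rewrite ler_wpM2l// lerD2r.
have iDD : P.-integrable setT (EFin \o (fun w => diam + D w)).
  apply: (@bounded_integrable _ _ _ _ _ (diam + m%:R * lam)) => [|w].
    exact: measurable_funD.
  rewrite (le_trans (ler_normD _ _))//.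
  by rewrite (ger0_norm diam0) lerD2l.
rewrite RintegralZl// RintegralD//; last exact: ir.
rewrite Rintegral_prob_cst ler_wpM2l// lerD2l.
exact: le_lam.
Qed.

(** Each map contributes one factor. Given the first map, the induction hypothesis treats the tail;
    the conditional mean, of oscillation at most [Gam * (diam + lam)], is then treated by
    [mgf_le_osc]. *)
Lemma mgf_path_value_le s m phi x : (m <= n.+1)%N -> sum_lip Gam m phi ->
  (\int[P]_w expR (s * path_value iota phi x w) <=
   expR (m%:R * (3 / 2 * (s * (Gam * (diam + lam))) ^+ 2)
         + s * \int[P]_w path_value iota phi x w))%R.
Proof.
elim: m phi x => [|m IHm] phi x mn lip.
  have cphi w : path_value iota phi x w = path_value iota phi x (point : Omega h).
    apply/eqP; rewrite -subr_eq0 -normr_le0.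
    by apply: le_trans (dist_path_value_le _ _ _ lip) _; rewrite mul0r mulr0.
  under eq_Rintegral do rewrite cphi.
  under [in leRHS]eq_Rintegral do rewrite cphi.
  by rewrite !Rintegral_prob_cst mul0r add0r.
set K := 3 / 2 * _ ^+ 2.
have mZ : measurable_fun setT (path_value iota phi x : Omega h -> R).
  exact: measurable_path_value lip.
set B := `|path_value iota phi x (point : Omega h)| + Gam * (m.+1%:R * (diam + lam)).
have ZB w : `|path_value iota phi x w| <= B by exact: path_value_bounded lip.
(* [H] is the conditional expectation given the first map. *)
pose H (v : Omega h) := (\int[P]_w path_value iota phi x (seq_cons (v 0%N) w))%R.
have mH : measurable_fun setT H by exact: measurable_Rintegral_seq_cons mZ ZB.
have HB (v : Omega h) : `|H v| <= B.
  apply: normr_Rintegral_le => [|b]; last exact: ZB.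
  exact: measurableT_comp mZ (measurable_seq_cons _).
have mexp (g : Omega h -> R) : measurable_fun setT g ->
    measurable_fun setT (fun w => expR (s * g w)).
  by move=> mg; apply: measurableT_comp => //; exact: measurable_funM.
have bexp (g : Omega h -> R) : (forall w, `|g w| <= B) ->
    forall w, `|expR (s * g w)| <= expR (`|s| * B).
  move=> gB w; rewrite ger0_norm ?expR_ge0// ler_expR (le_trans (ler_norm _))//.
  by rewrite normrM ler_wpM2l.
rewrite (Rintegral_seq_cons P_prod (mexp _ mZ) (bexp _ ZB)).
rewrite (Rintegral_seq_cons P_prod mZ ZB) -/H.
(* For a fixed head, the inner integral is the exponential moment of the path function with frozen
   head, started at the image of [x]. *)
apply: (@le_trans _ _ (\int[P]_v (expR (m%:R * K) * expR (s * H v)))%R).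
  apply: le_Rintegral => //.
  - apply: (@bounded_integrable _ _ _ _ _ (expR (`|s| * B))) => [|a].
      exact: measurable_Rintegral_seq_cons (mexp _ mZ) (bexp _ ZB).
    apply: normr_Rintegral_le => [|b]; last exact: (bexp _ ZB).
    exact: measurableT_comp (mexp _ mZ) (measurable_seq_cons _).
  - apply: (@bounded_integrable _ _ _ _ _ (expR (m%:R * K) * expR (`|s| * B))) => [|a].
      by apply: measurable_funM => //; exact: mexp.
    by rewrite normrM ger0_norm ?expR_ge0// ler_wpM2l ?expR_ge0//; exact: bexp.
  - move=> a _; rewrite -expRD /H.
    under eq_Rintegral do rewrite path_value_seq_cons.
    under [in leRHS]eq_Rintegral do rewrite path_value_seq_cons.
    by apply: IHm; [exact: ltnW|exact: sum_lip_fix_head].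
rewrite RintegralZl//; last exact: bounded_integrable (mexp _ mH) (bexp _ HB).
(* One copy of [K] is set aside for the randomness of the first map. *)
rewrite -natr1 mulrDl mul1r -addrA expRD ler_wpM2l ?expR_ge0//.
apply: (@mgf_le_osc _ _ _ P H _ s mH) => a b.
exact: (@Rintegral_path_value_head_le m phi x (a 0%N) (b 0%N) mn lip).
Qed.

End concentration.

(** * Real bounds from the suprema, and Chernoff's inequality *)

Lemma measurable_deviation {d} {T : measurableType d} {R : realType}
    (Z : T -> R) (e t : \bar R) : measurable_fun setT Z ->
  measurable [set w | t < (Z w)%:E - e]%E.
Proof.
move=> mZ; rewrite -[X in measurable X]setTI.
apply: emeasurable_fun_o_infty => //.
by apply: emeasurable_funB => //; exact/measurable_EFinP.
Qed.

Section constants.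
Context {R : realType} {M : metricType R} {C : pmetricType R}.
Variable iota : C -> continuousType M M.
Hypothesis iota_ptws : forall x : M, continuous (fun f : C => iota f x : M).
Variables (nu : probability (borel C) R) (h : nu (msupport nu) = 1%E).
Variable P : probability (Omega h) R.
Implicit Types x y : M.

Lemma mdist_le_diameter (a b : msupport nu) :
  ((mdist (\val a) (\val b))%:E <= diameter (msupport nu))%E.
Proof.
apply: ereal_sup_ubound; exists (\val a), (\val b).
by split => //; exact/set_mem/valP.
Qed.

Lemma le_lambda n x y :
  (\sum_(k < n.+1) 'E_P[fun w => mdist (X_ iota x k w) (X_ iota y k w)]
   <= lambda_ iota P n)%E.
Proof. by apply: ereal_sup_ubound; exists x, y. Qed.

Lemma expectation_dist_ge0 x y k :
  (0 <= 'E_P[fun w => mdist (X_ iota x k w) (X_ iota y k w)])%E.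
Proof. by apply: expectation_ge0 => w; exact: mdist_ge0. Qed.

(** The left-hand side is the term k = 0 of the sum, where the chains are still at their starting
    points. Hence a finite [lambda_] forces M to be bounded. *)
Lemma mdist_le_lambda n x y : ((mdist x y)%:E <= lambda_ iota P n)%E.
Proof.
apply: le_trans (le_lambda n x y); rewrite big_ord_recl -[leLHS]adde0.
apply: leeD; first by rewrite -(expectation_cst P (mdist x y)).
by apply: sume_ge0 => k _; exact: expectation_dist_ge0.
Qed.

Lemma Rintegral_sum_dist_le n (lam : R) m x y :
  lambda_ iota P n = lam%:E -> (m <= n.+1)%N ->
  (\int[P]_w (\sum_(k < m) mdist (X_ iota x k w) (X_ iota y k w)) <= lam)%R.
Proof.
move=> lamE mn.
have : (\int[P]_w (\sum_(k < m) mdist (X_ iota x k w) (X_ iota y k w))%:E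
        <= lam%:E)%E.
  under eq_integral do rewrite -sumEFin.
  rewrite ge0_integral_sum//; last first.
  - by move=> k w _; rewrite lee_fin mdist_ge0.
  - by move=> k; apply/measurable_EFinP; exact: measurable_dist_X.
  rewrite -lamE; apply: le_trans (le_lambda n x y).
  rewrite -!(big_mkord predT (fun k => 'E_P[fun w => mdist (X_ iota x k w) (X_ iota y k w)]%E)).
  rewrite -(big_mkord predT (fun k => \int[P]_w (mdist (X_ iota x k w) (X_ iota y k w))%:E)%E).
  rewrite (big_cat_nat (n := m) (leq0n m) mn)/= expectation.unlock leeDl//.
  by apply: sume_ge0 => k _; apply: integral_ge0 => w _; rewrite lee_fin mdist_ge0.
(* [Rintegral] sends infinite integrals to 0; the two bounds exclude both infinite values. *)
have : (0 <= \int[P]_w (\sum_(k < m) mdist (X_ iota x k w) (X_ iota y k w))%:E)%E.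
  by apply: integral_ge0 => w _; rewrite lee_fin sumr_ge0// => k _; exact: mdist_ge0.
rewrite /Rintegral; case: (integral _ _ _) => //=.
Qed.

Lemma sum_lip_ord n (gamma : 'I_n.+1 -> R)
    (phi : ('I_n.+1 -> msupport nu * M) -> R) :
  Lip (dist_sum (nu := nu)) gamma phi ->
  sum_lip (\big[Num.max/0]_(i < n.+1) gamma i) n.+1
    (fun u => phi (fun i : 'I_n.+1 => u i)).
Proof.
move=> lip u v; apply: le_trans (lip _ _) _.
rewrite mulr_sumr; apply: ler_sum => i _; apply: ler_wpM2r.
  by rewrite /dist_sum addr_ge0// mdist_ge0.
exact: le_bigmax.
Qed.

End constants.

(** The strict event lies in the event that [Z] is at least [t] plus its mean, to which Chernoff's
    inequality applies. *)
Lemma deviation_le_mgf {d} {T : measurableType d} {R : realType}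
    (P : probability T R) (Z : T -> R) (K s t : R) :
  measurable_fun setT Z -> (forall w, `|Z w| <= K) -> 0 < s ->
  (P [set w | t%:E < (Z w)%:E - 'E_P[Z]] <=
   (expR (- (s * (t + \int[P]_w Z w))) * \int[P]_w expR (s * Z w))%:E)%E.
Proof.
move=> mZ ZK s0.
have EZ : 'E_P[Z]%E = (\int[P]_w Z w)%R%:E.
  rewrite expectation.unlock fineK//; apply: integrable_fin_num => //.
  exact: bounded_integrable ZK.
have ie : P.-integrable setT (EFin \o (fun w => expR (s * Z w))).
  apply: (@bounded_integrable _ _ _ _ _ (expR (s * K))) => [|w].
    by apply: measurableT_comp => //; exact: measurable_funM.
  rewrite ger0_norm ?expR_ge0// ler_expR ler_pM2l//.
  exact: le_trans (ler_norm _) (ZK w).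
apply: le_trans (@le_measure _ _ _ P _ [set w | t + \int[P]_w Z w <= Z w]%R _ _ _) _.
- by rewrite inE; exact: measurable_deviation.
- rewrite inE -[X in measurable X]setTI.
  by rewrite -(preimage_itvcy Z); exact: mZ.
- by move=> w /=; rewrite EZ -EFinB lte_fin ltrBrDr => /ltW.
pose Zm : {mfun T >-> R} := HB.pack Z (isMeasurableFun.Build _ _ _ _ Z mZ).
apply: le_trans (chernoff (P := P) Zm (t + \int[P]_w Z w)%R s0) _.
rewrite muleC EFinM /mmt_gen_fun expectation.unlock fineK; last first.
  exact: integrable_fin_num.
rewrite le_eqVlt; apply/orP; left; apply/eqP; congr (_ * _)%E.
by apply: eq_integral => w _ /=; rewrite mulrC.
Qed.

(** * Degenerate cases and choice of the Chernoff parameter *)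

Theorem theorem1 (R : realType) (M : metricType R)
    (C : pmetricType R) (iota : C -> continuousType M M)
    (iota_inj : injective iota)
    (iota_ptws : forall x : M, continuous (fun f : C => iota f x : M))
    (nu : probability (borel C) R) (nu_supp : nu (msupport nu) = 1%E)
    (P : probability (Omega nu_supp) R) (P_prod : is_product_measure P)
    (n : nat) (n_gt0 : (0 < n)%N)
    (gamma : 'I_n.+1 -> R) (gamma_ge0 : forall i, 0 <= gamma i)
    (gamma_gt0 : exists i, 0 < gamma i)
    (phi : ('I_n.+1 -> msupport nu * M) -> R)
    (phi_lip : Lip (dist_sum (nu := nu)) gamma phi)
    (x : M) (t : R) (t_gt0 : 0 < t) :
  let Z (w : Omega nu_supp) : R := phi (fun k : 'I_n.+1 => Y_ iota x k w) in
  (P [set w | t%:E < (Z w)%:E - 'E_P[Z]] <=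
   expeR (- ((n%:R * t ^+ 2)%:E / (12%:R%:E * beta_ iota P gamma ^+ 2))))%E.
Proof.
cbv zeta; set Z := (fun w : Omega nu_supp => phi _).
pose phi' (u : nat -> msupport nu * M) := phi (fun i : 'I_n.+1 => u i).
have := sum_lip_ord phi_lip.
rewrite /beta_; set Gam := \big[Num.max/0]_(i < n.+1) gamma i => lip.
have Gam_gt0 : 0 < Gam.
  by have [i gi] := gamma_gt0; apply: lt_le_trans gi _; exact: le_bigmax.
have ZE : Z = path_value iota phi' x by [].
have mZ : measurable_fun setT Z.
  by rewrite ZE; apply: measurable_path_value lip => //; exact: ltW.
have mdev := measurable_deviation 'E_P[Z]%E t%:E mZ.
have diam0 : (0 <= diameter (msupport nu))%E.
  apply: le_trans (mdist_le_diameter (msupport_pt nu_supp) (msupport_pt nu_supp)).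
  by rewrite lee_fin mdist_ge0.
have lam0 : (0 <= lambda_ iota P n)%E.
  by apply: le_trans (mdist_le_lambda iota P n x x); rewrite lee_fin mdist_ge0.
(* Here [beta_] is infinite, the exponent is 0 and the bound is 1. Positivity of [n] and [Gam]
   matters, since 0 times [+oo] is 0. *)
have [dlE|] := eqVneq (diameter (msupport nu) + lambda_ iota P n)%E +oo%E.
  rewrite dlE gt0_muley ?lte_fin ?ltr0n// gt0_mulye ?lte_fin//.
  rewrite expe2 mulyy gt0_muley ?lte_fin ?ltr0n// invey mule0 oppe0 expeR0.
  exact: probability_le1.
case diamE : (diameter _) diam0 => [diam||]//; last first.
  by rewrite addye// -ltNye (lt_le_trans _ lam0).
case lamE : (lambda_ _ _ _) lam0 => [lam||]//; rewrite !lee_fin => lam0 diam0 _.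
pose c := Gam * (diam + lam).
have hdiam (a b : msupport nu) : mdist (\val a) (\val b) <= diam.
  by rewrite -lee_fin -diamE mdist_le_diameter.
have hlam0 (y z : M) : mdist y z <= lam.
  by rewrite -lee_fin -lamE; exact: mdist_le_lambda.
have hlam m y z : (m <= n)%N ->
    (\int[P]_w (\sum_(k < m) mdist (X_ iota y k w) (X_ iota z k w)) <= lam)%R.
  by move=> mn; apply: (Rintegral_sum_dist_le iota_ptws _ _ lamE); exact: leqW.
have c0 : 0 <= c by rewrite mulr_ge0 ?addr_ge0// ltW.
(* If [c] is 0 then [Z] is constant and the event is empty, whatever the right-hand side becomes
   under division by zero. *)
have [cz|cn0] := eqVneq c 0.
  have ZZ w : Z w = Z point.
    apply/eqP; rewrite -subr_eq0 -normr_le0.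
    apply: le_trans (dist_path_value_le iota (ltW Gam_gt0) hdiam hlam0 x w point lip) _.
    by rewrite mulrCA -/c cz mulr0.
  rewrite (_ : [set w | _] = set0) ?measure0 ?expeR_ge0//.
  apply/seteqP; split => // w /=.
  rewrite (_ : Z = cst (Z point)); last exact/funext.
  by rewrite expectation_cst/= subee// lte_fin ltNge ltW.
have c_gt0 : 0 < c by rewrite lt_neqAle eq_sym cn0.
have nR0 : 0 < n%:R :> R by rewrite ltr0n.
(* As n + 1 <= 2n, the exponent is at most - s t + 3 n (s c)^2. This [s] minimizes it, with minimum
   - t^2 / (12 n c^2); the latter is the required exponent because beta_n = n c. *)
pose s := t / (6 * n%:R * c ^+ 2).
have den0 : 0 < 6 * n%:R * c ^+ 2 by rewrite mulr_gt0 ?exprn_gt0// mulr_gt0.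
have s0 : 0 < s by rewrite divr_gt0.
have dev := @deviation_le_mgf _ _ _ P _ _ _ t mZ
  (fun w => path_value_bounded iota (ltW Gam_gt0) hdiam hlam0 x w lip) s0.
apply: le_trans dev _.
have mgf := mgf_path_value_le iota_ptws P_prod (ltW Gam_gt0) hdiam hlam0 hlam s x
  (leqnn n.+1) lip.
rewrite expe2 -EFinD -!EFinM -expr2 inver.
have -> : n%:R * (diam + lam) * Gam = n%:R * c by rewrite /c; ring.
have b0 : 0 < 12 * (n%:R * c) ^+ 2 by rewrite mulr_gt0 ?exprn_gt0// mulr_gt0.
rewrite gt_eqF// -EFinM -EFinN /= lee_fin.
apply: le_trans (ler_wpM2l (expR_ge0 _) mgf) _.
rewrite -expRD ler_expR -/c.
pose q := t ^+ 2 / (n%:R * c ^+ 2).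
have q0 : 0 <= q by rewrite divr_ge0 ?sqr_ge0// mulr_ge0 ?sqr_ge0// ltW.
have stE : s * t = q / 6 by rewrite /s /q; field; rewrite !gt_eqF.
have scE : n%:R * (s * c) ^+ 2 = q / 36 by rewrite /s /q; field; rewrite !gt_eqF.
have -> : n%:R * t ^+ 2 / (12 * (n%:R * c) ^+ 2) = q / 12.
  by rewrite /q; field; rewrite !gt_eqF.
have n1 : 1 <= n%:R :> R by rewrite ler1n.
have sc0 : 0 <= (s * c) ^+ 2 by exact: sqr_ge0.
(* The extra map, beyond the first [n], costs at most as much as those [n] together: the exponent is
   at most - q/6 + q/24 + q/24 = - q/12. *)
have : (s * c) ^+ 2 <= n%:R * (s * c) ^+ 2 by rewrite ler_peMl.
rewrite -natr1 mulrDr mulrDl mul1r stE [n%:R * (3 / 2 * _)]mulrCA scE.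
lra.
Qed.
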